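(* For all $X,Y,Z,W\in\Gamma(D)$, $$\overline{R}(X,Y,Z,W)=\overline{R}^D(X,Y,Z,W)+g(\overline{B}^*(Y,W),\overline{B}(X,Z))-g(\overline{B}^*(X,W),\overline{B}(Y,Z))+g(\overline{B}^*(Z,W),[X,Y]).$$
   Context: $(M,g)$ is a smooth Riemannian manifold with Levi-Civita connection $\nabla$. $D\subseteq TM$ is a smooth subbundle (distribution) of constant rank $n$ that is non integrable, i.e. there are $X,Y\in\Gamma(D)$ with $[X,Y]\notin\Gamma(D)$. $D^\bot$ is its orthogonal complement, $\pi^D:TM\to D$ and $\pi^{D^\bot}:TM\to D^\bot$ are the orthogonal projections, $[X,Y]^D=\pi^D[X,Y]$, $[X,Y]^{D^\bot}=\pi^{D^\bot}[X,Y]$. $(M,g,\overline\nabla)$ is a statistical manifold with dual connection $\overline\nabla^*$: $\overline\nabla_XY=\nabla_XY+K(X,Y)$, $\overline\nabla^*_XY=\nabla_XY-K(X,Y)$, where $K$ is a $(1,2)$-tensor field such that $C(X,Y,Z)=g(K(X,Y),Z)$ is totally symmetric. For $X,Y\in\Gamma(D)$: $\overline\nabla^D_XY=\pi^D(\overline\nabla_XY)$, $\overline B(X,Y)=\pi^{D^\bot}(\overline\nabla_XY)$, $\overline B^*(X,Y)=\pi^{D^\bot}(\overline\nabla^*_XY)$. Curvatures: $\overline R(X,Y)Z=\overline\nabla_X\overline\nabla_YZ-\overline\nabla_Y\overline\nabla_XZ-\overline\nabla_{[X,Y]}Z$ for vector fields on $M$, and for $X,Y,Z\in\Gamma(D)$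 $$\overline R^D(X,Y)Z=\overline\nabla^D_X\overline\nabla^D_YZ-\overline\nabla^D_Y\overline\nabla^D_XZ-\overline\nabla^D_{[X,Y]^D}Z-\pi^D[[X,Y]^{D^\bot},Z].$$ Also $\overline R(X,Y,Z,W)=g(\overline R(X,Y)Z,W)$, $\overline R^D(X,Y,Z,W)=g(\overline R^D(X,Y)Z,W)$. *)

(* Defs.v *)
From HB Require Import structures.
From mathcomp Require Import all_boot all_order all_algebra.
From mathcomp Require Import boolp classical_sets functions cardinality reals.
From mathcomp Require Import topology normedtype landau derive ring.
(* Smooth manifolds are given by atlases, tangent vectors at p are derivations
   at p of the algebra of smooth functions, vector fields are smooth sections of
   the tangent bundle, and the Riemannian metric and the (1,2)-tensor fields are
   smooth families of bilinear maps on the tangent spaces. *)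

Set Implicit Arguments.
Unset Strict Implicit.
Unset Printing Implicit Defensive.
Import Order.TTheory GRing.Theory Num.Theory.
Import numFieldNormedType.Exports.
Local Open Scope classical_set_scope.
Local Open Scope ring_scope.

Lemma near_eq_differentiable (R : realType) (V W : normedModType R)
    (f h : V -> W) x :
  (\near x, f x = h x) -> differentiable f x -> differentiable h x.
Proof.
move=> fh df; have fx : f x = h x := nbhs_singleton fh.
have /diff_locallyP[dc /eqaddoP dfE] := df.
have E : h \o shift x = cst (h x) + 'd f x +o_ 0 id.
  apply/eqaddoP => e e0.
  have fh0 : \forall y \near 0, f (y + x) = h (y + x).
    by move: fh; rewrite [in X in X -> _](near_shift 0) subr0.
  move: (dfE e e0); apply: filterS2 fh0 => y yE.
  by rewrite -fx /= !fctE /= yE.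
apply/diff_locallyP.
by rewrite (diff_unique dc E); split.
Qed.

Section Smooth.
Variables (R : realType) (m : nat).
Implicit Types (U : set 'rV[R]_m) (f h : 'rV[R]_m -> R).

Fixpoint iter_derive (s : seq 'rV[R]_m) f : 'rV[R]_m -> R :=
  if s is v :: s' then iter_derive s' (fun x => 'D_v f x) else f.

(* C^oo at every point of U *)
Definition smooth_in U f :=
  forall s x, U x -> differentiable (iter_derive s f) x.

Lemma iter_derive_eq_in U s f h : open U ->
  (forall x, U x -> f x = h x) ->
  forall x, U x -> iter_derive s f x = iter_derive s h x.
Proof.
move=> oU; elim: s f h => [//|v s IH] f h fh; apply: IH => x Ux.
apply: near_eq_derive.
by apply: filterS (open_nbhs_nbhs (conj oU Ux)) => y; exact: fh.
Qed.

Lemma smooth_in_ind U (P : ('rV[R]_m -> R) -> Prop) : open U ->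
  (forall f, P f -> forall x, U x -> differentiable f x) ->
  (forall f v, P f -> exists2 h, P h & forall x, U x -> 'D_v f x = h x) ->
  forall f, P f -> smooth_in U f.
Proof.
move=> oU Pd PD f Pf s; elim: s f Pf => [|v s IH] f Pf x Ux; first exact: Pd.
have [h Ph fh] := PD f v Pf.
apply: near_eq_differentiable (IH h Ph x Ux) => /=.
apply: filterS (open_nbhs_nbhs (conj oU Ux)) => y Uy.
by apply/esym/(iter_derive_eq_in s oU fh).
Qed.

Inductive smooth_alg U : ('rV[R]_m -> R) -> Prop :=
| SmoothBase f of smooth_in U f : smooth_alg U f
| SmoothAdd f h of smooth_alg U f & smooth_alg U h : smooth_alg U (f + h)
| SmoothMul f h of smooth_alg U f & smooth_alg U h : smooth_alg U (f * h).

Lemma smooth_in_alg U f : open U -> smooth_alg U f -> smooth_in U f.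
Proof.
move=> oU.
have df k : smooth_alg U k -> forall x, U x -> differentiable k x.
  elim=> {k} [k sk|k l _ dk _ dl|k l _ dk _ dl] x Ux.
  - exact: (sk [::]).
  - by apply: differentiableD; [exact: dk|exact: dl].
  - by apply: differentiableM; [exact: dk|exact: dl].
apply: (smooth_in_ind oU df) => k v.
elim=> {k} [k sk|k l sk [k' sk' kE] sl [l' sl' lE]|
                 k l sk [k' sk' kE] sl [l' sl' lE]].
- by exists (fun x => 'D_v k x) => //;
  apply: SmoothBase => s; exact: (sk (v :: s)).
- exists (k' + l') => [|x Ux]; first exact: SmoothAdd.
  rewrite deriveD ?kE ?lE//; apply: diff_derivable; exact: df.
- exists (k * l' + l * k') => [|x Ux].
    by apply: SmoothAdd; apply: SmoothMul.
  rewrite deriveM ?kE ?lE//; apply: diff_derivable; exact: df.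
Qed.

Lemma smooth_inD U f h : open U ->
  smooth_in U f -> smooth_in U h -> smooth_in U (f + h).
Proof.
by move=> oU sf sh; apply: smooth_in_alg => //;
  apply: SmoothAdd; exact: SmoothBase.
Qed.

Lemma smooth_inM U f h : open U ->
  smooth_in U f -> smooth_in U h -> smooth_in U (f * h).
Proof.
by move=> oU sf sh; apply: smooth_in_alg => //;
  apply: SmoothMul; exact: SmoothBase.
Qed.

Lemma smooth_in_cst U (a : R) : smooth_in U (cst a).
Proof.
move=> s; elim: s a => [|v s IH] a x Ux /=; first exact: differentiable_cst.
have -> : (fun y => 'D_v (cst a) y) = cst 0.
  by apply/funext => y; exact: derive_cst.
exact: IH.
Qed.
End Smooth.

(* chart_map and chart_inv only matter on chart_dom and on its image. *)
Record chart (R : realType) (m : nat) (T : topologicalType) := Chart {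
  chart_dom : set T;
  chart_map :> T -> 'rV[R]_m;
  chart_inv : 'rV[R]_m -> T;
  chart_dom_open : open chart_dom;
  chart_img_open : open (chart_map @` chart_dom);
  chart_mapK : {in chart_dom, cancel chart_map chart_inv};
  chart_map_continuous : {in chart_dom, continuous chart_map};
  chart_inv_continuous : {in chart_map @` chart_dom, continuous chart_inv}
}.

Definition smooth_transition (R : realType) (m : nat) (T : topologicalType)
    (c d : chart R m T) :=
  forall j, smooth_in (c @` (chart_dom c `&` chart_dom d))
                      (fun x => d (chart_inv c x) ord0 j).

Record manifold (R : realType) (m : nat) := Manifold {
  carrier :> topologicalType;
  atlas : set (chart R m carrier);
  manifold_hausdorff : hausdorff_space carrier;
  manifold_second_countable : @second_countable carrier;
  atlas_cover : forall p, exists2 c, atlas c & chart_dom c p;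
  atlas_smooth : forall c d, atlas c -> atlas d -> smooth_transition c d
}.

Arguments atlas {R m} M : rename.

Definition smooth_on (R : realType) (m : nat) (M : manifold R m) (U : set M)
    (f : M -> R) :=
  forall c, atlas M c ->
    smooth_in (c @` (chart_dom c `&` U)) (f \o chart_inv c).

Section SmoothFunctions.
Variables (R : realType) (m : nat) (M : manifold R m).

Definition smooth_pred : {pred (M -> R)} :=
  [pred f : M -> R | `[< smooth_on setT f >]].

Record smooth_fun := SmoothFun {
  smooth_fun_val :> M -> R;
  smooth_funP : smooth_fun_val \in smooth_pred
}.

HB.instance Definition _ := [isSub for smooth_fun_val].
HB.instance Definition _ := [Choice of smooth_fun by <:].

Lemma smooth_funE (f : smooth_fun) : smooth_on setT f.
Proof. by apply/asboolP; exact: (smooth_funP f). Qed.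

Definition mk_smooth_fun (f : M -> R) (sf : smooth_on setT f) : smooth_fun :=
  SmoothFun (introT (asboolP _) sf).

Lemma smooth_fun_ext (f h : smooth_fun) : (forall p, f p = h p) -> f = h.
Proof. by move=> fh; apply/val_inj/funext. Qed.

Lemma smooth_subring_closed : subring_closed smooth_pred.
Proof.
have oI (c : chart R m M) : open (c @` (chart_dom c `&` setT)).
  by rewrite setIT; exact: chart_img_open.
have cstP (a : R) : smooth_on [set: M] (cst a).
  by move=> c _; exact: smooth_in_cst.
have mulP (f h : M -> R) : smooth_on setT f -> smooth_on setT h ->
    smooth_on setT (f * h).
  move=> sf sh c ac.
  exact: (smooth_inM (oI c) (sf c ac) (sh c ac)).
split=> [|f h /asboolP sf /asboolP sh|f h /asboolP sf /asboolP sh].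
- by apply/asboolP; exact: (cstP 1).
- apply/asboolP => c ac.
  have sNh : smooth_on setT (cst (-1) * h) by apply: mulP.
  rewrite (_ : f - h = f + cst (-1) * h); last first.
    by apply/funext => p; rewrite !fctE mulN1r.
  exact: (smooth_inD (oI c) (sf c ac) (sNh c ac)).
- by apply/asboolP; exact: mulP.
Qed.

HB.instance Definition _ :=
  GRing.isSubringClosed.Build _ smooth_pred smooth_subring_closed.
HB.instance Definition _ :=
  GRing.SubChoice_isSubComPzRing.Build _ _ smooth_fun smooth_subring_closed.

Lemma smooth_fun_cst_subproof (a : R) : smooth_on [set: M] (cst a).
Proof. by move=> c _; exact: smooth_in_cst. Qed.

Definition smooth_cst (a : R) : smooth_fun :=
  mk_smooth_fun (smooth_fun_cst_subproof a).

End SmoothFunctions.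

Section Tangent.
Variables (R : realType) (m : nat) (M : manifold R m).
Local Notation F := (smooth_fun M).

Definition derivation_at (p : M) (v : F -> R^o) :=
  [/\ forall f h, v (f + h) = v f + v h,
      forall a f, v (smooth_cst M a * f) = a * v f
    & forall f h, v (f * h) = f p * v h + h p * v f].

Definition derivations (p : M) : {pred (F -> R^o)} :=
  [pred v : F -> R^o | `[< derivation_at p v >]].

Record tangent (p : M) := Tangent {
  tangent_fun :> F -> R^o;
  tangentP : tangent_fun \in derivations p
}.

HB.instance Definition _ p := [isSub for @tangent_fun p].
HB.instance Definition _ p := [Choice of tangent p by <:].

Lemma derivations_submod_closed p : submod_closed (derivations p).
Proof.
split=> [|a v w /asboolP[vD vZ vM] /asboolP[wD wZ wM]]; apply/asboolP; split.
- by move=> f h; exact: (esym (addr0 (0 : R))).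
- by move=> a f; exact: (esym (mulr0 a)).
- by move=> f h; rewrite -[RHS]/(f p * 0 + h p * 0) !mulr0 addr0.
- move=> f h; rewrite -[LHS]/(a * v (f + h) + w (f + h)) vD wD mulrDr.
  exact: addrACA.
- move=> b f; rewrite -[LHS]/(a * v _ + w _) vZ wZ (mulrCA a b) -mulrDr.
  by [].
- move=> f h; rewrite -[LHS]/(a * v _ + w _) vM wM mulrDr addrACA.
  by rewrite (mulrCA a (f p)) (mulrCA a (h p)) -!mulrDr.
Qed.

HB.instance Definition _ p :=
  GRing.isSubmodClosed.Build _ _ (derivations p) (derivations_submod_closed p).
HB.instance Definition _ p := [SubChoice_isSubLmodule of tangent p by <:].

Definition smooth_section_on (U : set M) (X : forall p, tangent p) :=
  forall f : F, smooth_on U (fun p => X p f).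

Record vfield := VField {
  vfield_val :> forall p, tangent p;
  vfieldP : smooth_section_on setT vfield_val
}.


Lemma tangent_ext p (u v : tangent p) : (forall f, u f = v f) -> u = v.
Proof. by move=> uv; apply/val_inj/funext. Qed.

Lemma vfield_ext (X Y : vfield) : (forall p, X p = Y p) -> X = Y.
Proof.
case: X Y => [X sX] [Y sY] /= XY.
have E : X = Y by exact: functional_extensionality_dep.
by subst Y; congr VField; exact: Prop_irrelevance.
Qed.

Definition der (X : vfield) (f : F) : F := mk_smooth_fun (vfieldP X f).

Lemma tangentE p (u : tangent p) : derivation_at p u.
Proof. by apply/asboolP; exact: (tangentP u). Qed.

HB.instance Definition _ := gen_eqMixin vfield.
HB.instance Definition _ := gen_choiceMixin vfield.

Lemma vf_zero_subproof : smooth_section_on setT (fun p => 0 : tangent p).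
Proof. by move=> f; exact: (smooth_funE (0 : F)). Qed.

Lemma vf_add_subproof (X Y : vfield) :
  smooth_section_on setT (fun p => X p + Y p).
Proof. by move=> f; exact: (smooth_funE (der X f + der Y f)). Qed.

Lemma vf_opp_subproof (X : vfield) : smooth_section_on setT (fun p => - X p).
Proof. by move=> f; exact: (smooth_funE (- der X f)). Qed.

Lemma vf_scale_subproof (h : F) (X : vfield) :
  smooth_section_on setT (fun p => h p *: X p).
Proof. by move=> f; exact: (smooth_funE (h * der X f)). Qed.

Definition vf_zero := VField vf_zero_subproof.
Definition vf_add X Y := VField (vf_add_subproof X Y).
Definition vf_opp X := VField (vf_opp_subproof X).
Definition vf_scale h X := VField (vf_scale_subproof h X).

Fact vf_addA : associative vf_add.
Proof. by move=> X Y Z; apply: vfield_ext => p; exact: addrA. Qed.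
Fact vf_addC : commutative vf_add.
Proof. by move=> X Y; apply: vfield_ext => p; exact: addrC. Qed.
Fact vf_add0 : left_id vf_zero vf_add.
Proof. by move=> X; apply: vfield_ext => p; exact: add0r. Qed.
Fact vf_addN : left_inverse vf_zero vf_opp vf_add.
Proof. by move=> X; apply: vfield_ext => p; exact: addNr. Qed.

HB.instance Definition _ :=
  GRing.isZmodule.Build vfield vf_addA vf_addC vf_add0 vf_addN.

Fact vf_scaleA h k X : vf_scale h (vf_scale k X) = vf_scale (h * k) X.
Proof. by apply: vfield_ext => p; exact: scalerA. Qed.
Fact vf_scale1 : left_id 1 vf_scale.
Proof. by move=> X; apply: vfield_ext => p; exact: scale1r. Qed.
Fact vf_scaleDr : right_distributive vf_scale +%R.
Proof. by move=> h X Y; apply: vfield_ext => p; exact: scalerDr. Qed.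
Fact vf_scaleDl X : {morph vf_scale^~ X : h k / h + k}.
Proof. by move=> h k; apply: vfield_ext => p; exact: scalerDl. Qed.

HB.instance Definition _ := GRing.Zmodule_isLmodule.Build F vfield
  vf_scaleA vf_scale1 vf_scaleDr vf_scaleDl.

Lemma lie_subproof (X Y : vfield) p :
  (fun f => X p (der Y f) - Y p (der X f) : R^o) \in derivations p.
Proof.
have [XD XZ XM] := tangentE (X p); have [YD YZ YM] := tangentE (Y p).
have derD (Z : vfield) f h : der Z (f + h) = der Z f + der Z h.
  by apply: smooth_fun_ext => q; have [ZD _ _] := tangentE (Z q); exact: ZD.
have derZ (Z : vfield) a f :
    der Z (smooth_cst M a * f) = smooth_cst M a * der Z f.
  by apply: smooth_fun_ext => q; have [_ ZZ _] := tangentE (Z q); exact: ZZ.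
have derM (Z : vfield) f h : der Z (f * h) = f * der Z h + h * der Z f.
  by apply: smooth_fun_ext => q; have [_ _ ZM] := tangentE (Z q); exact: ZM.
apply/asboolP; split.
- by move=> f h; rewrite !derD XD YD opprD addrACA.
- by move=> a f; rewrite !derZ XZ YZ -mulrBr.
- move=> f h; rewrite !derM XD YD !XM !YM.
  have derp (Z : vfield) k : der Z k p = Z p k by [].
  by rewrite !derp; ring.
Qed.

Definition lie_at (X Y : vfield) p : tangent p := Tangent (lie_subproof X Y p).

Lemma lie_smooth_subproof (X Y : vfield) : smooth_section_on setT (lie_at X Y).
Proof.
by move=> f; exact: (smooth_funE (der X (der Y f) - der Y (der X f))).
Qed.

Definition lie (X Y : vfield) : vfield := VField (lie_smooth_subproof X Y).

End Tangent.

Section Geometry.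
Variables (R : realType) (m : nat) (M : manifold R m).
Local Notation F := (smooth_fun M).
Local Notation vfield := (vfield M).

Record riem_metric := RiemMetric {
  riem_val :> forall p : M, tangent p -> tangent p -> R;
  riem_linear : forall p a (u v w : tangent p),
    riem_val (a *: u + v) w = a * riem_val u w + riem_val v w;
  riem_sym : forall p (u v : tangent p), riem_val u v = riem_val v u;
  riem_pos : forall p (u : tangent p), u != 0 -> 0 < riem_val u u;
  riem_smooth : forall X Y : vfield,
    smooth_on setT (fun p => riem_val (X p) (Y p))
}.

Definition inner (g : riem_metric) (X Y : vfield) : F :=
  mk_smooth_fun (riem_smooth g X Y).

Record tensor12 := Tensor12 {
  tensor_val :> forall p : M, tangent p -> tangent p -> tangent p;
  tensor_linearl : forall p a (u v w : tangent p),
    tensor_val (a *: u + v) w = a *: tensor_val u w + tensor_val v w;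
  tensor_linearr : forall p a (u v w : tangent p),
    tensor_val w (a *: u + v) = a *: tensor_val w u + tensor_val w v;
  tensor_smooth : forall X Y : vfield,
    smooth_section_on setT (fun p => tensor_val (X p) (Y p))
}.

Definition tensor_app (K : tensor12) (X Y : vfield) : vfield :=
  VField (tensor_smooth K X Y).

(* total symmetry of C(u, v, w) = g(K(u, v), w); the two transpositions
   generate all permutations of the arguments *)
Definition cubic_symmetric (g : riem_metric) (K : tensor12) :=
  forall p (u v w : tangent p),
    g p (K p u v) w = g p (K p v u) w /\ g p (K p u v) w = g p (K p u w) v.

(* R-linearity in Y is the Leibniz rule for constant functions. *)
Record connection := Connection {
  conn_val :> vfield -> vfield -> vfield;
  conn_linear : forall (f : F) X X' Y,
    conn_val (f *: X + X') Y = f *: conn_val X Y + conn_val X' Y;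
  conn_additive : forall X Y Y',
    conn_val X (Y + Y') = conn_val X Y + conn_val X Y';
  conn_leibniz : forall X (f : F) Y,
    conn_val X (f *: Y) = der X f *: Y + f *: conn_val X Y
}.

Definition levi_civita (g : riem_metric) (nabla : connection) :=
  (forall X Y, nabla X Y - nabla Y X = lie X Y) /\
  (forall X Y Z,
     der X (inner g Y Z) = inner g (nabla X Y) Z + inner g Y (nabla X Z)).

Definition frame_of (n : nat) (V : lmodType R) (A : set V) (e : 'I_n -> V) :=
  (forall a : 'I_n -> R, \sum_i a i *: e i = 0 -> forall i, a i = 0) /\
  A = [set v | exists a : 'I_n -> R, v = \sum_i a i *: e i].

(* Smooth subbundle of TM of constant rank n, given by local frames. *)
Record distribution (n : nat) := Distribution {
  fiber :> forall p : M, set (tangent p);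
  distribution_frame : forall p : M, exists (U : set M)
      (E : 'I_n -> forall q : M, tangent q),
    [/\ open U, U p, forall i, smooth_section_on U (E i)
      & forall q, U q -> frame_of (fiber (p := q)) (fun i => E i q)]
}.

Definition sections (A : forall p : M, set (tangent p)) : set vfield :=
  [set X | forall p, A p (X p)].

Definition integrable n (D : distribution n) :=
  forall X Y, sections D X -> sections D Y -> sections D (lie X Y).

Definition orth_compl (g : riem_metric) (A : forall p : M, set (tangent p)) :
    forall p : M, set (tangent p) :=
  fun p => [set u | forall v, A p v -> g p u v = 0].

(* P is the action on vector fields of the g-orthogonal projection of TM
   onto A *)
Definition orth_projection (g : riem_metric) (A : forall p : M, set (tangent p))
    (P : vfield -> vfield) :=
  forall X p, A p (P X p) /\ orth_compl g A (X p - P X p).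

Definition stat_conn (nabla : connection) (K : tensor12) (X Y : vfield) :
    vfield := nabla X Y + tensor_app K X Y.

Definition dual_conn (nabla : connection) (K : tensor12) (X Y : vfield) :
    vfield := nabla X Y - tensor_app K X Y.

Definition curvature (nb : vfield -> vfield -> vfield) (X Y Z : vfield) :
    vfield :=
  nb X (nb Y Z) - nb Y (nb X Z) - nb (lie X Y) Z.

(* The next definitions take as P and Q the orthogonal projections onto a
   distribution and onto its orthogonal complement. *)
Definition dist_conn (P : vfield -> vfield) (nb : vfield -> vfield -> vfield)
    (X Y : vfield) : vfield := P (nb X Y).

Definition second_form (Q : vfield -> vfield) (nb : vfield -> vfield -> vfield)
    (X Y : vfield) : vfield := Q (nb X Y).

Definition dist_curvature (P Q : vfield -> vfield)
    (nb : vfield -> vfield -> vfield) (X Y Z : vfield) : vfield :=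
  dist_conn P nb X (dist_conn P nb Y Z) - dist_conn P nb Y (dist_conn P nb X Z)
  - dist_conn P nb (P (lie X Y)) Z - P (lie (Q (lie X Y)) Z).

End Geometry.

(* Main.v *)
Require Import Defs.
From mathcomp Require Import all_boot all_order all_algebra.
From mathcomp Require Import boolp classical_sets functions reals.
From mathcomp Require Import topology normedtype derive.
From mathcomp Require Import ring.
Import GRing.Theory.
Local Open Scope ring_scope.

Set Implicit Arguments.
Unset Strict Implicit.

(** The identity is the Gauss equation of a distribution.  As for submanifolds,
    one differentiates a section of [D] twice and keeps track of the part that
    leaves [D] after the first derivative.

    A connection and its dual satisfy
      [X g(Y,Z) = g(nb_X Y, Z) + g(Y, nb*_X Z)]
    ([stat_dual_metric]; the total symmetry of the cubic form makes the two
    contributions of [K] cancel).  If [N] is normal to [D] and [W] is tangent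
    to it, the left-hand side vanishes for the pair [(N, W)], which gives the
    Weingarten equation [g(nb_V N, W) = - g(B*(V,W), N)] ([weingarten]).

    In [nb_X nb_Y Z], split [nb_Y Z] into its tangent part, which contributes
    to the curvature of [D], and its normal part [B(Y,Z)], which the Weingarten
    equation turns into [- g(B*(X,W), B(Y,Z))]; likewise with [X] and [Y]
    exchanged ([gauss_second_derivative]).  Unlike for a submanifold, the
    bracket of [X] and [Y] may have a normal part [N], and the connection of
    [D] does not differentiate in that direction.  But [nb] is torsion-free
    ([stat_torsion_free]), so [nb_N Z] is the bracket of [N] and [Z] plus
    [nb_Z N]: the first summand is the correction term in the curvature of [D],
    and the Weingarten equation turns the second one into the last term of the
    identity ([gauss_derivative_direction]). *)

Section Metric.
Variables (R : realType) (m : nat) (M : manifold R m) (g : riem_metric M).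

Lemma riemDl (p : M) (u v w : tangent p) : g p (u + v) w = g p u w + g p v w.
Proof. by have := riem_linear g 1 u v w; rewrite scale1r mul1r. Qed.

Lemma riemBl (p : M) (u v w : tangent p) : g p (u - v) w = g p u w - g p v w.
Proof. by apply/eqP; rewrite eq_sym subr_eq -riemDl subrK. Qed.

Lemma riem_nondegenerate (p : M) (u v : tangent p) :
  (forall w, g p u w = g p v w) -> u = v.
Proof.
move=> uv; apply/eqP; rewrite -subr_eq0; apply/negPn/negP => /(riem_pos g).
by rewrite riemBl uv subrr Order.POrderTheory.ltxx.
Qed.

Lemma innerC (X Y : vfield M) : inner g X Y = inner g Y X.
Proof. by apply: smooth_fun_ext => p; exact: riem_sym. Qed.

Lemma innerDl (X Y Z : vfield M) :
  inner g (X + Y) Z = inner g X Z + inner g Y Z.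
Proof. by apply: smooth_fun_ext => p; exact: riemDl. Qed.

Lemma innerBl (X Y Z : vfield M) :
  inner g (X - Y) Z = inner g X Z - inner g Y Z.
Proof. by apply: smooth_fun_ext => p; exact: riemBl. Qed.

Lemma innerBr (X Y Z : vfield M) :
  inner g X (Y - Z) = inner g X Y - inner g X Z.
Proof. by rewrite innerC innerBl !(innerC X). Qed.

Lemma der0 (X : vfield M) : der X 0 = 0.
Proof.
apply: smooth_fun_ext => p; have [XD _ _] := tangentE (X p).
by apply: (@addrI _ (X p 0)); rewrite addr0 -[LHS]XD addr0.
Qed.

End Metric.

Section OrthogonalSplitting.
Variables (R : realType) (m : nat) (M : manifold R m) (g : riem_metric M).
Variables (A : forall p : M, set (tangent p)) (P Q : vfield M -> vfield M).
Hypotheses (hP : orth_projection g A P)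
           (hQ : orth_projection g (orth_compl g A) Q).

(** The difference [X - P X - Q X] lies both in the orthogonal complement of
    [A] and in the complement of that complement, so it is orthogonal to
    itself. *)
Lemma orth_split (X : vfield M) : X = P X + Q X.
Proof.
apply: vfield_ext => p; have [AP AoP] := hP X p; have [AoQ AooQ] := hQ X p.
pose u := X p - (P X p + Q X p).
have uo : orth_compl g A u.
  move=> v Av; rewrite /u opprD addrA riemBl (AoP v Av).
  by rewrite (AoQ v Av) subr0.
have uu0 : g p u u = 0.
  rewrite {1}/u opprD addrCA addrC riemBl (AooQ u uo).
  by rewrite riem_sym (uo _ AP) subr0.
apply/eqP; rewrite -subr_eq0 -/u; apply/negPn/negP => /(riem_pos g).
by rewrite uu0 Order.POrderTheory.ltxx.
Qed.

Lemma inner_normal_tangent (X W : vfield M) :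
  sections A W -> inner g (Q X) W = 0.
Proof.
by move=> AW; apply: smooth_fun_ext => p; have [AoQ _] := hQ X p; exact: AoQ.
Qed.

Lemma inner_tangent_projection (X W : vfield M) :
  sections A W -> inner g (P X) W = inner g X W.
Proof.
by move=> AW; rewrite {2}(orth_split X) innerDl inner_normal_tangent// addr0.
Qed.

Lemma inner_normal_projection (X V : vfield M) :
  inner g (Q V) (Q X) = inner g V (Q X).
Proof.
rewrite {2}(orth_split V) innerDl (innerC g (P V)).
rewrite (@inner_normal_tangent X (P V)) ?add0r// => p.
by have [] := hP V p.
Qed.

End OrthogonalSplitting.

Section StatisticalStructure.
Variables (R : realType) (m : nat) (M : manifold R m) (g : riem_metric M).
Variables (nabla : connection M) (K : tensor12 M).
Hypotheses (hnabla : levi_civita g nabla) (hK : cubic_symmetric g K).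
Local Notation nb := (stat_conn nabla K).
Local Notation nbs := (dual_conn nabla K).

Lemma stat_connDl (X Y Z : vfield M) : nb (X + Y) Z = nb X Z + nb Y Z.
Proof.
rewrite /stat_conn; have := conn_linear nabla 1 X Y Z; rewrite !scale1r => ->.
rewrite addrACA; congr (_ + _); apply: vfield_ext => p.
by have := tensor_linearl K 1 (X p) (Y p) (Z p); rewrite !scale1r.
Qed.

Lemma stat_connDr (X Y Z : vfield M) : nb X (Y + Z) = nb X Y + nb X Z.
Proof.
rewrite /stat_conn conn_additive addrACA; congr (_ + _).
apply: vfield_ext => p.
by have := tensor_linearr K 1 (Y p) (Z p) (X p); rewrite !scale1r.
Qed.

Lemma tensor_appC (X Y : vfield M) : tensor_app K X Y = tensor_app K Y X.
Proof.
apply: vfield_ext => p; apply: (@riem_nondegenerate _ _ _ g) => w.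
by have [] := hK (X p) (Y p) w.
Qed.

(** The symmetric tensor [K] drops out of the antisymmetrization. *)
Lemma stat_torsion_free (X Y : vfield M) : nb X Y = lie X Y + nb Y X.
Proof.
have [tf _] := hnabla.
by rewrite -tf /stat_conn tensor_appC addrA subrK.
Qed.

Lemma stat_dual_metric (X Y Z : vfield M) :
  der X (inner g Y Z) = inner g (nb X Y) Z + inner g Y (nbs X Z).
Proof.
have [_ ->] := hnabla; rewrite innerDl innerBr.
have -> : inner g (tensor_app K X Y) Z = inner g Y (tensor_app K X Z).
  rewrite [RHS]innerC; apply: smooth_fun_ext => p.
  by have [] := hK (X p) (Y p) (Z p).
by rewrite addrACA subrr addr0.
Qed.

Variables (A : forall p : M, set (tangent p)) (P Q : vfield M -> vfield M).
Hypotheses (hP : orth_projection g A P)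
           (hQ : orth_projection g (orth_compl g A) Q).

(** Differentiating [g(Q N, W) = 0] moves the derivative from the normal field
    to the tangent one, where the dual connection appears. *)
Lemma weingarten (V N W : vfield M) : sections A W ->
  inner g (nb V (Q N)) W = - inner g (second_form Q nbs V W) (Q N).
Proof.
move=> AW; apply/eqP; rewrite -addr_eq0 /second_form.
rewrite (inner_normal_projection hP hQ) (innerC g _ (Q N)) -stat_dual_metric.
by rewrite (inner_normal_tangent hQ) // der0.
Qed.

(** The tangent part of a second derivative of a section: the induced second
    derivative, corrected by the normal part of the first derivative. *)
Lemma gauss_second_derivative (X Y Z W : vfield M) : sections A W ->
  inner g (nb X (nb Y Z)) W =
  inner g (dist_conn P nb X (dist_conn P nb Y Z)) W
  - inner g (second_form Q nbs X W) (second_form Q nb Y Z).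
Proof.
move=> AW; rewrite {1}(orth_split hP hQ (nb Y Z)) stat_connDr innerDl.
by rewrite (weingarten X) // /dist_conn (inner_tangent_projection hP hQ).
Qed.

(** The direction [V] is split; in its normal part, torsion-freeness exchanges
    the direction and the argument, so that the Weingarten equation applies. *)
Lemma gauss_derivative_direction (V Z W : vfield M) : sections A W ->
  inner g (nb V Z) W =
  inner g (dist_conn P nb (P V) Z) W + inner g (P (lie (Q V) Z)) W
  - inner g (second_form Q nbs Z W) V.
Proof.
move=> AW; rewrite {1}(orth_split hP hQ V) stat_connDl innerDl.
rewrite (stat_torsion_free (Q V)) innerDl (weingarten Z) //.
rewrite /dist_conn !(inner_tangent_projection hP hQ) // /second_form.
by rewrite (innerC g _ (Q V)) (inner_normal_projection hP hQ) (innerC g V) addrA.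
Qed.

End StatisticalStructure.

Unset Implicit Arguments.
Set Strict Implicit.

Theorem theorem4p1 (R : realType) (m n : nat) (M : manifold R m)
    (g : riem_metric M) (nabla : connection M) (K : tensor12 M)
    (D : distribution M n) (piD piDperp : vfield M -> vfield M)
    (hnabla : levi_civita g nabla)
    (hK : cubic_symmetric g K)
    (hD : ~ integrable D)
    (hpiD : orth_projection g (fiber D) piD)
    (hpiDperp : orth_projection g (orth_compl g (fiber D)) piDperp)
    (X Y Z W : vfield M)
    (hX : sections (fiber D) X) (hY : sections (fiber D) Y)
    (hZ : sections (fiber D) Z) (hW : sections (fiber D) W) :
  let nb := stat_conn nabla K in
  let nbs := dual_conn nabla K in
  let B := second_form piDperp nb in
  let Bs := second_form piDperp nbs in
  inner g (curvature nb X Y Z) W =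
    inner g (dist_curvature piD piDperp nb X Y Z) W
    + inner g (Bs Y W) (B X Z) - inner g (Bs X W) (B Y Z)
    + inner g (Bs Z W) (lie X Y).
Proof.
move=> nb nbs B Bs; rewrite /curvature /dist_curvature !innerBl.
rewrite !(gauss_second_derivative hnabla hK hpiD hpiDperp) //.
rewrite (gauss_derivative_direction hnabla hK hpiD hpiDperp) //.
rewrite -/nb -/nbs -/B -/Bs; ring.
Qed.
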